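(* For any minimal homeomorphism $f$ of a Cantor set $X$, the ample group $\mathsf{F}(\langle f\rangle)$ has Property E.
   Context: A homeomorphism $f:X\to X$ of a Cantor set is minimal if there is no closed set $Y\subset X$ different from $\emptyset$ and $X$ with $f(Y)\subset Y$. $\langle f\rangle$ is the cyclic group generated by $f$. For a group $G$ of homeomorphisms of $X$, its full amplification $\mathsf{F}(G)$ is the group of all homeomorphisms $h$ of $X$ such that every point $x\in X$ has an open neighborhood $U_x$ on which $h$ coincides with some element of $G$; one has $\mathsf{F}(\mathsf{F}(G))=\mathsf{F}(G)$, i.e. $\mathsf{F}(G)$ is ample. For a clopen (closed and open) set $U\subset X$ and $\mathcal{G}=\mathsf{F}(\langle f\rangle)$, the local subgroup $\mathcal{G}_U$ consists of all $g\in\mathcal{G}$ such that $g(x)=x$ for all $x\notin U$. Property E for $\mathcal{G}$: for any clopen sets $U_1,U_2\subset X$ with $U_1\cap U_2\ne\emptyset$, the group $\mathcal{G}_{U_1\cup U_2}$ is generated by $\mathcal{G}_{U_1}\cup\mathcal{G}_{U_2}$. *)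

(* Defs.v *)
From HB Require Import structures.
From mathcomp Require Import all_boot.
From mathcomp Require Import all_classical.
From mathcomp Require Import reals topology cantor.

Set Implicit Arguments.
Unset Strict Implicit.
Unset Printing Implicit Defensive.

Local Open Scope classical_set_scope.

Record homeo (X Y : topologicalType) := Homeo {
  homeo_fun :> X -> Y;
  homeo_inv : Y -> X;
  homeo_funK : cancel homeo_fun homeo_inv;
  homeo_invK : cancel homeo_inv homeo_fun;
  homeo_cts : continuous homeo_fun;
  homeo_inv_cts : continuous homeo_inv
}.

(* The inverse is determined by the map, so homeomorphisms are equal as soon
   as the underlying functions agree. *)
Lemma homeoP (X Y : topologicalType) (g h : homeo X Y) : g =1 h -> g = h.
Proof.
case: g h => [g g' gK g'K gc g'c] [h h' hK h'K hc h'c] /= gh.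
have e : g = h by apply/funext.
subst h; have e : g' = h'.
  by apply/funext => y; rewrite -{1}(h'K y) gK.
by subst h'; congr Homeo; exact: Prop_irrelevance.
Qed.

HB.instance Definition _ (X Y : topologicalType) :=
  gen_eqMixin (homeo X Y).
HB.instance Definition _ (X Y : topologicalType) :=
  gen_choiceMixin (homeo X Y).

Section HomeoGroup.
Variable X : topologicalType.
Implicit Types g h k : homeo X X.

Definition homeo_id : homeo X X :=
  @Homeo X X idfun idfun (fun=> erefl) (fun=> erefl)
    (fun x => @cvg_id _ (nbhs x)) (fun x => @cvg_id _ (nbhs x)).

Definition homeo_V g : homeo X X :=
  Homeo (homeo_invK g) (homeo_funK g) (homeo_inv_cts (h := g)) (homeo_cts (h := g)).

Definition homeo_comp g h : homeo X X :=
  @Homeo X X (g \o h) (homeo_inv h \o homeo_inv g)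
    (can_comp (homeo_funK g) (homeo_funK h))
    (can_comp (homeo_invK h) (homeo_invK g))
    (fun x => @continuous_comp _ _ _ h g x
       (@homeo_cts _ _ h x) (@homeo_cts _ _ g (h x)))
    (fun x => @continuous_comp _ _ _ (homeo_inv g) (homeo_inv h) x
       (@homeo_inv_cts _ _ g x) (@homeo_inv_cts _ _ h (homeo_inv g x))).

Lemma homeo_compA : associative homeo_comp.
Proof. by move=> g h k; exact: homeoP. Qed.

Lemma homeo_comp1g : left_id homeo_id homeo_comp.
Proof. by move=> g; exact: homeoP. Qed.

Lemma homeo_compg1 : right_id homeo_id homeo_comp.
Proof. by move=> g; exact: homeoP. Qed.

Lemma homeo_compVg : left_inverse homeo_id homeo_V homeo_comp.
Proof. by move=> g; apply: homeoP => x /=; exact: homeo_funK. Qed.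

Lemma homeo_compgV : right_inverse homeo_id homeo_V homeo_comp.
Proof. by move=> g; apply: homeoP => x /=; exact: homeo_invK. Qed.

HB.instance Definition _ := isGroup.Build (homeo X X)
  homeo_compA homeo_comp1g homeo_compg1 homeo_compVg homeo_compgV.

End HomeoGroup.

Definition cantor_set (X : topologicalType) : Prop :=
  inhabited (homeo X cantor_space).

Definition generated (G : groupType) (S : set G) : set G :=
  smallest (fun H : set G => group_closed [in H]) S.

Section FullAmplification.
Variable X : topologicalType.

Definition minimal (f : homeo X X) : Prop :=
  ~ exists Y : set X, [/\ closed Y, Y <> set0, Y <> setT & f @` Y `<=` Y].

Definition full_amplification (G : set (homeo X X)) : set (homeo X X) :=
  [set h : homeo X X | forall x, exists U : set X,
     [/\ open U, U x & exists2 g, G g & forall y, U y -> h y = g y]].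

Definition local_subgroup (G : set (homeo X X)) (U : set X) :
    set (homeo X X) :=
  [set g : homeo X X | G g /\ forall x, ~ U x -> g x = x].

Definition property_E (G : set (homeo X X)) : Prop :=
  forall U1 U2 : set X, clopen U1 -> clopen U2 -> U1 `&` U2 !=set0 ->
    generated (local_subgroup G U1 `|` local_subgroup G U2) =
    local_subgroup G (U1 `|` U2).

End FullAmplification.

(* Main.v *)
(* Write U = U1 `|` U2, W = U1 `&` U2, and let H be the group generated by the
   two local subgroups. Since every orbit visits W, a swap of two disjoint
   clopen sets A, phi A in U is locally conjugate, through a third set
   f^m A in W, to a swap inside U1 or U2; by compactness all swaps are in H.
   Given g in G_U with g x = f^(n x) x and |n x| <= N, let Y be a tiny clopen set
   and V the union of the levels f^i Y for i <= 2N. Off V, the map g preserves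
   the segments of f-orbits cut out by f^N Y, so that swaps, one for each
   hitting time of f^N Y, reduce g to an element supported in V `&` U. Finally
   swaps of the levels f^i Y in U with levels f^n Y in W conjugate this element
   into G_W. *)
Require Import Defs.
From mathcomp Require Import all_boot all_classical topology.
From mathcomp Require Import cantor zify.
Local Open Scope classical_set_scope.

Set Implicit Arguments.
Unset Strict Implicit.

(** * Compactness arguments and local continuity *)

(** If [Q setT] failed, the complements of the sets satisfying [Q] would form a proper filter; a
    cluster point of it has no neighbourhood satisfying [Q]. *)
Lemma compact_set_ind (X : topologicalType) (Q : set X -> Prop) :
  compact [set: X] -> Q set0 ->
  (forall A B, A `<=` B -> Q B -> Q A) ->
  (forall A B, Q A -> Q B -> Q (A `|` B)) ->
  (forall x : X, exists2 B, nbhs x B & Q B) -> Q setT.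
Proof.
move=> cX Q0 Qsub QU Qloc; apply: contrapT => nQ.
pose F : set_system X := [set B | Q (~` B)].
have FF : ProperFilter F.
  split; first by rewrite /F /= setC0.
  split; rewrite /F /=.
  - by rewrite setCT.
  - by move=> A B QA QB; change (Q (~` (A `&` B))); rewrite setCI; exact: QU.
  - by move=> A B AB; apply: Qsub; exact: subsetC.
have [|x [_ Fx]] := cX F FF; first by rewrite /F /= setCT.
have [B xB QB] := Qloc x.
have [|y [nBy By]] := Fx (~` B) B _ xB; first by rewrite /F /= setCK.
exact: nBy.
Qed.

Lemma continuous_local (X Y : topologicalType) (h : X -> Y) :
  (forall x, exists U, [/\ open U, U x &
     exists2 g : X -> Y, continuous g & forall y, U y -> h y = g y]) ->
  continuous h.
Proof.
move=> hloc x B hxB.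
have [U [oU Ux [g cg hg]]] := hloc x.
rewrite (hg x Ux) in hxB.
have UB : nbhs x (U `&` g @^-1` B).
  by apply: filterI; [exact: open_nbhs_nbhs|exact: cg].
by apply: filterS UB => y [Uy]; rewrite /= hg.
Qed.

Lemma clopen_nbhs (X : topologicalType) (A : set X) (x : X) :
  clopen A -> A x -> nbhs x A.
Proof. by move=> [oA _] Ax; exact: open_nbhs_nbhs. Qed.

(** * Subgroups and generated subgroups *)

Lemma group_closed_inP (G : groupType) (S : set G) :
  group_closed [in S] <->
  S 1%g /\ forall x y, S x -> S y -> S (x * y^-1)%g.
Proof.
split=> -[S1 SB]; split; rewrite ?inE in S1 *; rewrite ?inE //.
- by move=> x y Sx Sy; have := SB x y; rewrite !inE; exact.
- by move=> x y; rewrite !inE; exact: SB.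
Qed.

Section GroupClosed.
Variables (G : groupType) (S : set G).
Hypothesis gS : group_closed [in S].

Lemma group_closed_in1 : S 1%g.
Proof. by case/group_closed_inP: gS. Qed.

Lemma group_closed_inV x : S x -> S x^-1%g.
Proof.
case/group_closed_inP: gS => S1 SB Sx.
by rewrite -(mul1g x^-1%g); exact: SB.
Qed.

Lemma group_closed_inM x y : S x -> S y -> S (x * y)%g.
Proof.
case/group_closed_inP: gS => S1 SB Sx Sy.
by rewrite -(invgK y); apply: SB => //; exact: group_closed_inV.
Qed.

Lemma group_closed_inX x n : S x -> S (x ^+ n)%g.
Proof.
move=> Sx; elim: n => [|n IH]; first by rewrite expg0; exact: group_closed_in1.
by rewrite expgS; exact: group_closed_inM.
Qed.

End GroupClosed.

Section Generated.
Variables (G : groupType) (S : set G).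

Lemma sub_generated : S `<=` generated S.
Proof. exact: sub_gen_smallest. Qed.

Lemma generated_sub (K : set G) :
  group_closed [in K] -> S `<=` K -> generated S `<=` K.
Proof. by move=> gK SK x; apply; split. Qed.

Lemma generated_closed : group_closed [in generated S].
Proof.
apply/group_closed_inP; split.
  by move=> K [/group_closed_inP[]].
move=> x y Sx Sy K [gK SK].
case/group_closed_inP: (gK) => _; apply; [exact: Sx|exact: Sy].
Qed.

End Generated.

(** * Homeomorphisms, their iterates, and clopen sets *)

Section Homeo.
Variable X : topologicalType.
Implicit Types (f g h : homeo X X) (A : set X).

Lemma homeo_mulE g h x : (g * h)%g x = g (h x).
Proof. by []. Qed.

Lemma homeo_mulKV g x : g (g^-1%g x) = x.
Proof. exact: (homeo_invK g). Qed.

Lemma homeo_mulVK g x : g^-1%g (g x) = x.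
Proof. exact: (homeo_funK g). Qed.

Lemma homeo_inj g : injective g.
Proof. exact: can_inj (homeo_funK g). Qed.

Lemma homeo_expE f n x : (f ^+ n)%g x = iter n f x.
Proof. by elim: n => [//|n IH]; rewrite expgS homeo_mulE IH. Qed.

Lemma homeo_iter_inj f n : injective (iter n f).
Proof. by move=> x y; rewrite -!homeo_expE; exact: homeo_inj. Qed.

Lemma clopen_homeo g A : clopen A -> clopen (g @^-1` A).
Proof.
move=> cA; apply: preimage_clopen => //.
by move=> x; exact: homeo_cts.
Qed.

Lemma open_homeo g A : open A -> open (g @^-1` A).
Proof. by move=> oA; apply: open_comp => // x _; exact: homeo_cts. Qed.

Lemma clopen_iter f n A : clopen A -> clopen (iter n f @^-1` A).
Proof.
move=> cA; rewrite (_ : iter n f = (f ^+ n)%g :> (X -> X)) //.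
  exact: clopen_homeo.
by apply/funext => x; rewrite homeo_expE.
Qed.

Lemma clopen_levels f m A : clopen A ->
  clopen [set x | exists2 i, i < m & exists2 y, A y & iter i f y = x].
Proof.
move=> cA; elim: m => [|m IH].
  rewrite (_ : mkset _ = set0); first exact: clopen0.
  by apply/seteqP; split=> x // [].
rewrite (_ : mkset _ = [set x | exists2 i, i < m &
    exists2 y, A y & iter i f y = x] `|` (f ^+ m)^-1%g @^-1` A).
  by apply: clopenU => //; exact: clopen_homeo.
apply/seteqP; split => [x [i im [y Ay <-]]|x [[i im xi]|Ax]].
- have [im'|mi] := ltnP i m; first by left; exists i => //; exists y.
  right => /=; have -> : i = m by lia.
  by rewrite -homeo_expE homeo_funK.
- by exists i => //; lia.
- exists m => //; exists ((f ^+ m)^-1%g x) => //.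
  by rewrite -homeo_expE homeo_mulKV.
Qed.

End Homeo.

(** * Full amplifications and their local subgroups *)

Section Amplification.
Variables (X : topologicalType) (G : set (homeo X X)).
Hypothesis gG : group_closed [in G].
Local Notation F := (full_amplification G).

Lemma sub_full_amplification : G `<=` F.
Proof. by move=> g Gg x; exists setT; split; [exact: openT|by []|exists g]. Qed.

Lemma full_amplification_closed : group_closed [in F].
Proof.
apply/group_closed_inP; split.
  by apply: sub_full_amplification; exact: group_closed_in1.
move=> g h Fg Fh x.
have [U [oU Ux [g0 Gg0 gg0]]] := Fg (h^-1%g x).
have [V [oV Vx [h0 Gh0 hh0]]] := Fh (h^-1%g x).
exists (h^-1%g @^-1` (U `&` V)); split => //.
  by apply: open_homeo; exact: openI.
exists (g0 * h0^-1)%g.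
  by apply: group_closed_inM => //; exact: group_closed_inV.
move=> y [Uy Vy]; rewrite !homeo_mulE gg0 //; congr (g0 _).
by rewrite -{2}(homeo_mulKV h y) hh0 // homeo_mulVK.
Qed.

(** This is the ampleness of [F]: on the intersection of the two neighbourhoods a single element of
    [G] serves. *)
Lemma full_amplification_ample (h : homeo X X) :
  (forall x, exists U, [/\ open U, U x &
     exists2 g, F g & forall y, U y -> h y = g y]) -> F h.
Proof.
move=> hloc x; have [U [oU Ux [g Fg hg]]] := hloc x.
have [V [oV Vx [g0 Gg0 gg0]]] := Fg x.
exists (U `&` V); split; [exact: openI|by []|exists g0 => // y [Uy Vy]].
by rewrite hg // gg0.
Qed.

Lemma local_subgroup_closed (U : set X) :
  group_closed [in local_subgroup F U].
Proof.
have gF := full_amplification_closed.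
apply/group_closed_inP; split; first by split=> //; exact: (group_closed_in1 gF).
move=> g h [Fg gU] [Fh hU]; split.
  by apply: (group_closed_inM gF) => //; exact: (group_closed_inV gF).
by move=> x nUx; rewrite homeo_mulE -{1}(hU x nUx) homeo_mulVK gU.
Qed.

End Amplification.

(** * Swaps of disjoint clopen sets *)

Section Swap.
Variable X : topologicalType.
Implicit Types (A : set X) (phi t : homeo X X).

(** Stated as a relation that fixes [t] pointwise, so identities between products of swaps reduce to
    the cases of [swap_case]. *)
Definition is_swap A phi t :=
  [/\ forall x, A x -> t x = phi x, forall x, A x -> t (phi x) = x &
      forall x, ~ A x -> (forall y, A y -> phi y <> x) -> t x = x].

Lemma swap_case A phi x :
  [\/ A x, exists2 y, A y & x = phi y |
      ~ A x /\ forall y, A y -> phi y <> x].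
Proof.
have [Ax|nAx] := pselect (A x); first exact: Or31.
have [[y Ay xy]|nex] := pselect (exists2 y, A y & x = phi y).
  by apply: Or32; exists y.
by apply: Or33; split => // y Ay yx; apply: nex; exists y.
Qed.

Lemma swap_exists A phi : clopen A -> (forall x, A x -> ~ A (phi x)) ->
  exists t, is_swap A phi t.
Proof.
move=> cA dA.
pose t x := if `[< A x >] then phi x
  else if `[< A (phi^-1%g x) >] then phi^-1%g x else x.
have t1 x : A x -> t x = phi x by move=> Ax; rewrite /t asboolT.
have t2 x : A x -> t (phi x) = x.
  move=> Ax; rewrite /t asboolF; last exact: dA.
  by rewrite homeo_mulVK asboolT.
have t3 x : ~ A x -> (forall y, A y -> phi y <> x) -> t x = x.
  move=> nAx nx; rewrite /t !asboolF // => Ax.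
  by have := nx _ Ax; rewrite homeo_mulKV.
have tK : cancel t t.
  move=> x; have [Ax|[y Ay ->]|[nAx nx]] := swap_case A phi x.
  - by rewrite (t1 x) // t2.
  - by rewrite (t2 y) // t1.
  - by rewrite !t3.
have ct : continuous t.
  apply: continuous_local => x.
  have [Ax|[y Ay ->]|[nAx nx]] := swap_case A phi x.
  - exists A; split; [exact: cA.1|by []|exists phi => //].
    by move=> z; exact: homeo_cts.
  - exists (phi^-1%g @^-1` A); split.
    + exact/open_homeo/cA.1.
    + by rewrite /= homeo_funK.
    + exists phi^-1%g; first by move=> z; exact: homeo_cts.
      by move=> z Az; rewrite -{1}(homeo_mulKV phi z) t2.
  - exists (~` A `&` ~` (phi^-1%g @^-1` A)); split.
    + by apply: openI; apply: closed_openC; [|apply: (clopen_homeo _ _).2];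
        case: cA.
    + by split => // Ax; apply: (nx _ Ax); rewrite homeo_mulKV.
    + exists id; first by move=> z; exact: cvg_id.
      move=> z [nAz nz]; apply: t3 => // y Ay yz.
      by apply: nz; rewrite -yz /= homeo_funK.
by exists (@Homeo X X t t tK tK ct ct).
Qed.

Lemma swap_full_amplification (G : set (homeo X X)) A phi t :
  group_closed [in G] -> clopen A -> full_amplification G phi ->
  is_swap A phi t -> full_amplification G t.
Proof.
move=> gG cA Fphi [t1 t2 t3].
have gF := full_amplification_closed gG.
apply: full_amplification_ample => x.
have [Ax|[y Ay ->]|[nAx nx]] := swap_case A phi x.
- by exists A; split; [exact: cA.1|by []|exists phi].
- exists (phi^-1%g @^-1` A); split.
  + exact/open_homeo/cA.1.
  + by rewrite /= homeo_funK.
  + exists phi^-1%g; first exact: (group_closed_inV gF).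
    by move=> z Az; rewrite -{1}(homeo_mulKV phi z) t2.
- exists (~` A `&` ~` (phi^-1%g @^-1` A)); split.
  + by apply: openI; apply: closed_openC; [|apply: (clopen_homeo _ _).2];
      case: cA.
  + by split => // Ax; apply: (nx _ Ax); rewrite homeo_mulKV.
  + exists 1%g; first exact: (group_closed_in1 gF).
    move=> z [nAz nz]; apply: t3 => // y Ay yz.
    by apply: nz; rewrite -yz /= homeo_funK.
Qed.

End Swap.

(** * Cantor sets and minimal homeomorphisms *)

Section CantorSet.
Variable X : topologicalType.
Hypothesis hX : cantor_set X.

Lemma cantor_set_compact : compact [set: X].
Proof.
case: hX => e.
have <- : homeo_inv e @` setT = setT.
  by apply/seteqP; split => // x _; exists (e x) => //; exact: homeo_funK.
apply: continuous_compact; last exact: cantor_space_compact.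
by apply: continuous_subspaceT => x; exact: homeo_inv_cts.
Qed.

Lemma cantor_set_zero_dimensional : zero_dimensional X.
Proof.
case: hX => e x y xy.
have [|U [cU Ux nUy]] := @cantor_zero_dimensional (e x) (e y).
  by apply: contra_neq xy => /(can_inj (homeo_funK e)).
exists (e @^-1` U); split => //; apply: preimage_clopen => //.
by move=> z; exact: homeo_cts.
Qed.

Lemma cantor_set_not_isolated (x : X) : ~ open [set x].
Proof.
case: hX => e ox; have /perfectTP/(_ (e x)) := cantor_perfect; apply.
rewrite (_ : [set e x] = homeo_inv e @^-1` [set x]).
  by apply: open_comp => // z _; exact: homeo_inv_cts.
apply/seteqP; split => [z ->|z /= <-]; first exact: homeo_funK.
by rewrite homeo_invK.
Qed.

(** Without isolated points, [W] contains some [z] other than [a], and a clopen set separates the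
    two; the points of [s] are removed one by one. *)
Lemma cantor_set_clopen_avoid (W : set X) (s : seq X) :
  clopen W -> W !=set0 ->
  exists W', [/\ clopen W', W' !=set0, W' `<=` W & forall x, x \in s -> ~ W' x].
Proof.
elim: s W => [|a s IH] W cW W0; first by exists W; split.
have [z Wz za] : exists2 z, W z & z != a.
  apply: contrapT => nz; have Wa z : W z -> z = a.
    by move=> Wz; apply/eqP; apply: contrapT => /negP za; apply: nz; exists z.
  apply: (@cantor_set_not_isolated a); rewrite (_ : [set a] = W) ?cW.1 //.
    by case: cW.
  apply/seteqP; split => [b ->|b /Wa] //.
  by case: W0 => c Wc; rewrite -(Wa c Wc).
have [E [cE Ez nEa]] := cantor_set_zero_dimensional za.
have [||W' [cW' W'0 sub W's]] := IH (W `&` E).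
- exact: clopenI.
- by exists z.
exists W'; split => // [y /sub[]//|x]; rewrite in_cons => /orP[/eqP ->|/W's//].
by move=> /sub[].
Qed.

Variable f : homeo X X.
Hypothesis hf : minimal f.

(** Otherwise the points whose forward orbit avoids [Y] form a closed, forward invariant set,
    nonempty because of [x] and proper because of [Y]. *)
Lemma minimal_visit (Y : set X) x : open Y -> Y !=set0 ->
  exists n, Y (iter n f x).
Proof.
move=> oY [y Yy]; apply: contrapT => nY; apply: hf.
exists [set z | forall n, ~ Y (iter n f z)]; split.
- rewrite (_ : mkset _ = \bigcap_n ~` (iter n f @^-1` Y)).
    apply: closed_bigI => n _; apply: open_closedC.
    rewrite (_ : iter n f = (f ^+ n)%g :> (X -> X)); first exact: open_homeo.
    by apply/funext => z; rewrite homeo_expE.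
  by apply/seteqP; split => z h n; [move=> _|]; exact: h.
- by move=> e; have : set0 x; [rewrite -e => n Yn; apply: nY; exists n|].
- by move=> e; have : setT y by []; rewrite -e => /(_ 0); exact.
- by move=> _ [z hz <-] n; rewrite -iterSr; exact: hz.
Qed.

Lemma minimal_visit_after (Y : set X) x m : open Y -> Y !=set0 ->
  exists2 n, m <= n & Y (iter n f x).
Proof.
move=> oY Y0; have [n Yn] := minimal_visit (iter m f x) oY Y0.
by exists (n + m); rewrite ?iterD //; lia.
Qed.

(** A periodic orbit would be finite, and some nonempty clopen set avoids it, against
    [minimal_visit]. *)
Lemma minimal_aperiodic n x : 0 < n -> iter n f x <> x.
Proof.
move=> n0 fx.
have [||W [cW W0 _ nW]] :=
  @cantor_set_clopen_avoid setT [seq iter i f x | i <- iota 0 n].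
- exact: clopenT.
- by exists x.
have [m Wm] := minimal_visit x cW.1 W0.
apply: nW Wm; apply/mapP; exists (m %% n).
  by rewrite mem_iota /= add0n ltn_mod.
rewrite {1}(divn_eq m n) addnC iterD; congr iter.
by elim: (m %/ n) => // q IH; rewrite mulSn iterD IH.
Qed.

Lemma minimal_small_clopen n x : exists2 Y : set X, clopen Y /\ Y x &
  forall i y, 0 < i <= n -> Y y -> ~ Y (iter i f y).
Proof.
elim: n => [|n [Y [cY Yx] dY]].
  by exists setT; [split; [exact: clopenT|]|lia].
have [|E [cE Ex nE]] := @cantor_set_zero_dimensional x (iter n.+1 f x).
  by apply/eqP => /esym; exact: minimal_aperiodic.
exists (Y `&` E `&` ~` (iter n.+1 f @^-1` E)).
  split; last by [].
  by apply: clopenI; [exact: clopenI|exact/clopenC/clopen_iter].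
move=> i y /andP[i0]; rewrite leq_eqVlt => /orP[/eqP->|iln].
  by move=> [_ nEy] [[_ Ei] _]; exact: nEy.
move=> [[Yy _] _] [[Yi _] _]; apply: (dY i y) => //; lia.
Qed.

End CantorSet.

(** * Bounded displacement along orbits *)

(** The power [f^(b - a)] is recorded by two natural exponents, which avoids negative iterates. *)
Lemma generated1P (X : topologicalType) (f g : homeo X X) :
  generated [set f] g ->
  exists a b, forall x, iter a f (g x) = iter b f x.
Proof.
suff sub : generated [set f] `<=` [set g | exists a b, forall x,
  iter a f (g x) = iter b f x] by exact: sub.
clear g; apply: generated_sub; last by move=> _ ->; exists 0, 1.
apply/group_closed_inP; split; first by exists 0, 0.
move=> g h [a [b gab]] [c [d hcd]]; exists (a + d), (c + b) => x.
rewrite homeo_mulE addnC iterD gab -iterD addnC iterD -hcd homeo_mulKV.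
by rewrite -iterD addnC.
Qed.

(** Near each point [g] is one power of [f]; compactness makes the exponents uniformly bounded. *)
Lemma full_amplification_bounded (X : topologicalType) (f g : homeo X X) :
  compact [set: X] -> full_amplification (generated [set f]) g ->
  exists N, forall x, exists a b,
    [/\ a <= N, b <= N & iter a f (g x) = iter b f x].
Proof.
move=> cX Fg.
pose Q (B : set X) := exists N, forall x, B x -> exists a b,
    [/\ a <= N, b <= N & iter a f (g x) = iter b f x].
suff [N hN] : Q setT by exists N => x; exact: hN.
apply: (compact_set_ind cX).
- by exists 0.
- by move=> A B AB [N hN]; exists N => x /AB; exact: hN.
- move=> A B [M hM] [N hN]; exists (M + N) => x [/hM|/hN] [a [b [aN bN e]]];
  by exists a, b; split => //; lia.
- move=> x; have [U [oU Ux [g0 /generated1P[a [b gab]] gg0]]] := Fg x.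
  exists U; first exact: open_nbhs_nbhs.
  by exists (a + b) => y Uy; exists a, b; rewrite gg0 //; split => //; lia.
Qed.

(** * Generation of the local subgroup of [U] *)

Section LocalGroups.
Variables (X : topologicalType) (f : homeo X X).
Hypotheses (hX : cantor_set X) (hf : minimal f).
Local Notation G := (full_amplification (generated [set f])).
Variables (U W : set X) (H : set (homeo X X)).
Hypotheses (cU : clopen U) (cW : clopen W) (W0 : W !=set0) (WU : W `<=` U).
Hypotheses (gH : group_closed [in H]) (HG : H `<=` G).
(** For Property E, [V] will be [U1] or [U2]. Both contain the overlap [W], through which points are
    carried from one to the other. *)
Hypothesis coverH : forall x, U x -> exists V,
  [/\ clopen V, W `<=` V, V x & local_subgroup G V `<=` H].

Let gG : group_closed [in G].
Proof. exact/full_amplification_closed/generated_closed. Qed.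

Let Gf n : G (f ^+ n)%g.
Proof.
apply: (group_closed_inX gG).
by apply: sub_full_amplification; exact: sub_generated.
Qed.

Let cX : compact [set: X].
Proof. exact: cantor_set_compact. Qed.

(** With [f^m x] in [W], the swap [s] of [A'] and [f^m A'] lives in [V1], and conjugation by [s]
    turns [t] into a swap of [f^m A'] and [phi A'], which lives in [V2]. *)
Lemma swap_local (A : set X) (phi : homeo X X) x :
  (forall y, A y -> ~ A (phi y)) -> G phi -> U x -> U (phi x) ->
  exists C, [/\ clopen C, C x & forall A' t, clopen A' -> A' `<=` A `&` C ->
    is_swap A' phi t -> H t].
Proof.
move=> dA Gphi Ux Uphix.
have [V1 [cV1 WV1 V1x V1H]] := coverH Ux.
have [V2 [cV2 WV2 V2x V2H]] := coverH Uphix.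
(* Avoiding [x] and [phi x] makes [A'], [phi A'] and [f^m A'] pairwise disjoint once [A'] is
   small. *)
have [W' [cW' W'0 W'W nW']] :=
  cantor_set_clopen_avoid hX [:: x; phi x] cW W0.
have [m W'm] := minimal_visit hf x cW'.1 W'0.
exists (V1 `&` phi @^-1` V2 `&` iter m f @^-1` W' `&`
  (~` W' `&` phi @^-1` ~` W')); split.
- apply: clopenI; first apply: clopenI; first apply: clopenI => //.
  + exact: clopen_homeo.
  + exact: clopen_iter.
  + by apply: clopenI; [|apply: clopen_homeo]; exact: clopenC.
- by split => //; split; apply: nW'; rewrite !inE eqxx ?orbT.
move=> A' t cA' sA' st.
have [s ss] : exists s, is_swap A' (f ^+ m)%g s.
  apply: swap_exists => // y /sA'[_ [[_ W'y] _]] /sA'[_ [_ [+ _]]].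
  by rewrite homeo_expE; exact.
have Hs : H s.
  apply: V1H; split.
    exact: (swap_full_amplification (@generated_closed _ _) _ _ ss).
  case: ss => _ _ s3 y nV1y; apply: s3.
    by move=> /sA'[_ [[[]]]].
  move=> z /sA'[_ [[_ W'z] _]] zy; apply: nV1y; rewrite -zy homeo_expE.
  exact/WV1/W'W.
suff Hc : H (s * t * s^-1)%g.
  rewrite (_ : t = s^-1 * (s * t * s^-1) * s)%g.
    apply: (group_closed_inM gH) => //; apply: (group_closed_inM gH) => //.
    exact: (group_closed_inV gH).
  by rewrite !mulgA mulVg mul1g -mulgA mulVg mulg1.
have Gt : G t by exact: (swap_full_amplification (@generated_closed _ _) _ _ st).
apply: V2H; split.
  apply: (group_closed_inM gG); last by apply: (group_closed_inV gG); exact: HG.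
  by apply: (group_closed_inM gG) => //; exact: HG.
move=> y nV2y; rewrite 2!homeo_mulE; set u := s^-1%g y.
have yE : y = s u by rewrite homeo_mulKV.
suff -> : t u = u by [].
(* If [u] lies in [A'] then [y] lies in [W]; if [u] lies in [phi A'] then [s] fixes [u] and [y] lies
   in [V2]. Both are excluded. *)
case: st => t1 t2 t3; case: ss => s1 s2 s3.
have [A'u|[v A'v uE]|[nu nu']] := swap_case A' phi u.
- case: nV2y; rewrite yE s1 // homeo_expE; apply/WV2/W'W.
  by case: (sA' u A'u) => _ [[_ +] _].
- case: nV2y; rewrite yE uE; case: (sA' v A'v) => Av [[[_ V2v] _] [_ nW'v]].
  rewrite s3 //.
    by move=> /sA'[Aphi _]; exact: dA Av Aphi.
  move=> w /sA'[_ [[_ W'w] _]] wv; apply: nW'v; rewrite /= -wv homeo_expE.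
  exact: W'w.
- exact: t3.
Qed.

Lemma swap_generated (A : set X) (phi t : homeo X X) :
  clopen A -> A `<=` U -> A `<=` phi @^-1` U ->
  (forall x, A x -> ~ A (phi x)) -> G phi -> is_swap A phi t -> H t.
Proof.
move=> cA AU phiAU dA Gphi st.
(* The clopen [C] around [B] allows cutting a swap along [C]; quantifying over all clopen [A']
   inside it covers the resulting pieces. *)
pose Q (B : set X) := exists2 C, clopen C /\ B `<=` C &
  forall A' t, clopen A' -> A' `<=` A `&` C -> is_swap A' phi t -> H t.
have empty A' s : A' `<=` set0 -> is_swap A' phi s -> H s.
  move=> A'0 [_ _ s3]; rewrite (_ : s = 1%g); first exact: (group_closed_in1 gH).
  by apply: homeoP => x; apply: s3 => [/A'0|y /A'0].
suff [C [_ CT] hC] : Q setT.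
  by apply: (hC A) => // x Ax; split => //; exact: CT.
apply: (compact_set_ind cX).
- exists set0; first by split=> //; exact: clopen0.
  by move=> A' s _; rewrite setI0; exact: empty.
- move=> B B' sB [C [cC B'C] hC]; exists C => //; split => //.
  exact: subset_trans B'C.
- move=> B1 B2 [C1 [cC1 BC1] h1] [C2 [cC2 BC2] h2]; exists (C1 `|` C2).
    by split; [exact: clopenU|exact: setUSS].
  move=> A' s cA' sA' [s1 s2 s3].
  have dA' (D : set X) x : (A' `&` D) x -> ~ (A' `&` D) (phi x).
    by move=> [/sA'[Ax _] _] [/sA'[Apx _] _]; exact: dA Apx.
  have cD1 : clopen (A' `&` C1) by exact: clopenI.
  have cD2 : clopen (A' `&` ~` C1) by apply: clopenI => //; exact: clopenC.
  have [r1 hr1] := swap_exists cD1 (dA' C1).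
  have [r2 hr2] := swap_exists cD2 (dA' (~` C1)).
  have Hr1 : H r1 by apply: h1 hr1 => // x [/sA'[]].
  have Hr2 : H r2 by apply: h2 hr2 => // x [/sA'[? []]].
  rewrite (_ : s = r1 * r2)%g; first exact: (group_closed_inM gH).
  case: hr1 => p1 p2 p3; case: hr2 => q1 q2 q3.
  (* [A'] and [phi A'] are disjoint, so [r1] and [r2] have disjoint supports and each point is moved
     by at most one of them. *)
  have disj x y : A' x -> A' y -> phi x <> y.
    by move=> /sA'[Ax _] /sA'[Ay _] xy; apply: (dA x) => //; rewrite xy.
  apply: homeoP => x; rewrite homeo_mulE.
  have [A'x|[y A'y ->]|[nx nx']] := swap_case A' phi x.
  + rewrite s1 //; have [C1x|nC1x] := pselect (C1 x).
      by rewrite q3 ?p1 // => [[]//|y [A'y _]]; exact: disj.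
    rewrite q1 // p3 // => [[A'p _]|y [A'y C1y] /homeo_inj yx].
      exact: disj A'x A'p _.
    by apply: nC1x; rewrite -yx.
  + rewrite s2 //; have [C1y|nC1y] := pselect (C1 y).
      rewrite q3 ?p2 // => [[A'p _]|z [A'z nC1z] /homeo_inj zy].
        exact: disj A'y A'p _.
      by apply: nC1z; rewrite zy.
    by rewrite q2 // p3 // => [[]//|z [A'z _]]; exact: disj.
  + rewrite s3 // q3 ?p3 // => [[//]|y [A'y _]|[//]|y [A'y _]]; exact: nx'.
- move=> x; have [Ax|nAx] := pselect (A x).
    have [C [cC Cx hC]] := swap_local dA Gphi (AU x Ax) (phiAU x Ax).
    by exists C; [exact: clopen_nbhs|exists C => //; split].
  have cnA := clopenC A cA.
  exists (~` A); first exact: clopen_nbhs.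
  by exists (~` A); [split|move=> A' s _; rewrite setICr; exact: empty].
Qed.

(** Level [m] is swapped with a level [n] lying in [W]. The bound [M] on the support of [k], uniform
    in [Y], lets the induction choose [n] beyond everything moved before. *)
Lemma absorb_levels (x : X) m : exists2 Y0 : set X, clopen Y0 /\ Y0 x &
  exists M, forall Y, clopen Y -> Y `<=` Y0 -> exists k, [/\ H k,
    forall y i, Y y -> i < m -> U (iter i f y) -> W (k (iter i f y)) &
    forall z, (forall y j, Y y -> j < M -> iter j f y <> z) -> k z = z].
Proof.
elim: m => [|m [Y0 [cY0 Y0x] [M hM]]].
  exists setT; first by split; [exact: clopenT|].
  by exists 0 => Y _ _; exists 1%g; split => //; exact: (group_closed_in1 gH).
have cUm := clopen_iter f m cU.
have [Ux|nUx] := pselect (U (iter m f x)); last first.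
  (* Shrinking keeps all of level [m] outside [U], so the old [k] still works. *)
  exists (Y0 `&` ~` (iter m f @^-1` U)).
    by split => //; apply: clopenI => //; exact: clopenC.
  exists M => Y cY sY.
  have [|k [Hk kW kid]] := hM Y cY; first by move=> y /sY[].
  exists k; split => // y i Yy; rewrite ltnS leq_eqVlt => /orP[/eqP -> Um|].
    by case: (sY y Yy) => _ [].
  exact: kW.
have [n nM Wn] := minimal_visit_after hf x (maxn M m.+1) cW.1 W0.
(* Inside [Y1] the levels 0 to [n] are pairwise disjoint. *)
have [Y1 [cY1 Y1x] dY1] := minimal_small_clopen hX hf n x.
exists (Y0 `&` Y1 `&` (iter m f @^-1` U `&` iter n f @^-1` W)).
  split => //; apply: clopenI; apply: clopenI => //; exact: clopen_iter.
exists n.+1 => Y cY sY.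
have [|k [Hk kW kid]] := hM Y cY; first by move=> y /sY[[]].
have neq i j y z : Y y -> Y z -> i < j <= n -> iter j f z <> iter i f y.
  move=> /sY[[_ Yy] _] /sY[[_ Yz] _] ijn.
  rewrite (_ : j = i + (j - i))%N; last by lia.
  rewrite iterD => /homeo_iter_inj e.
  by apply: (dY1 (j - i) z) => //; [lia|rewrite e].
pose A := (f ^+ m)^-1%g @^-1` Y.
have AP z : A z -> exists2 y, Y y & z = iter m f y.
  by move=> Az; exists ((f ^+ m)^-1%g z) => //; rewrite -homeo_expE homeo_mulKV.
have AY y : Y y -> A (iter m f y).
  by move=> Yy; rewrite -homeo_expE /A /= homeo_funK.
have phiE y : (f ^+ (n - m))%g (iter m f y) = iter n f y.
  by rewrite homeo_expE -iterD subnK //; lia.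
have cA : clopen A by exact: clopen_homeo.
have dA z : A z -> ~ A ((f ^+ (n - m))%g z).
  move=> /AP[y Yy ->]; rewrite phiE => /AP[z' Yz' e].
  by apply: (neq m n z' y) => //; lia.
have [t st] := swap_exists cA dA.
have Ht : H t.
  apply: (swap_generated cA _ _ dA _ st) => //.
  - by move=> z /AP[y Yy ->]; case: (sY y Yy) => _ [].
  - by move=> z /AP[y Yy ->]; rewrite /= phiE; apply: WU; case: (sY y Yy) => _ [].
case: st => t1 t2 t3.
(* [t] acts first: it sends level [m] to level [n], which [k] fixes, and leaves the levels below [m]
   to [k]. *)
exists (k * t)%g; split; first exact: (group_closed_inM gH).
- move=> y i Yy; rewrite homeo_mulE ltnS leq_eqVlt => /orP[/eqP -> _|im Ui].
    rewrite t1 ?phiE; last exact: AY.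
    rewrite kid; first by case: (sY y Yy) => _ [].
    by move=> z j Yz jM /esym; apply: neq => //; lia.
  rewrite t3; first exact: kW.
    by move=> /AP[z Yz /esym]; apply: neq => //; lia.
  by move=> _ /AP[z Yz ->]; rewrite phiE; apply: neq => //; lia.
- move=> z hz; rewrite homeo_mulE t3.
  + by apply: kid => y j Yy jM; apply: hz => //; lia.
  + by move=> /AP[y Yy /esym]; apply: hz => //; lia.
  + by move=> _ /AP[y Yy ->]; rewrite phiE; apply: hz => //; lia.
Qed.

(* A point of level [l x = m] moved by [g] inside its fibre of [b] leaves the
   level, so the part of the level that [g] moves off it can be swapped back;
   this fixes the level and creates no new moved points off [V]. *)
Lemma clear_levels (T : Type) (b : X -> T) (l : X -> nat) L
    (V : set X) (g : homeo X X) :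
  (forall x y, b x = b y -> l x = l y -> x = y) ->
  (forall m, clopen [set x | l x = m]) -> (forall x, l x < L) -> clopen V ->
  local_subgroup G U g -> (forall x, ~ V x -> b (g x) = b x) ->
  exists2 h, H h & local_subgroup G (U `&` V) (h * g)%g.
Proof.
move=> bl_inj cl lL cV gUg gb.
suff [h [Hh [Ghg hgU] _ hgid]] : exists h, [/\ H h, local_subgroup G U (h * g)%g,
    forall x, ~ V x -> b ((h * g)%g x) = b x &
    forall x, ~ V x -> l x < L -> (h * g)%g x = x].
  exists h => //; split => // x nUVx.
  have [Vx|nVx] := pselect (V x); last exact: hgid.
  by apply: hgU => Ux; exact: nUVx.
elim: {lL} L => [|m [h [Hh [Gq qU] qb qid]]].
  exists 1%g; split => //; rewrite ?mul1g //; exact: (group_closed_in1 gH).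
set q := (h * g)%g in Gq qU qb qid.
pose A := U `&` ~` V `&` ([set x | l x = m] `&` ~` (q @^-1` [set x | l x = m])).
have cA : clopen A.
  apply: clopenI; first by apply: clopenI => //; exact: clopenC.
  apply: clopenI; first exact: cl.
  apply: clopenC => //; exact: (@clopen_homeo X q _ (cl m)).
have dA x : A x -> ~ A (q x) by move=> [_ [_ +]] [_ [+ _]].
have Aq x : A x -> U (q x).
  move=> [[Ux _] _]; apply: contrapT => nUq; apply: (nUq).
  by have := qU _ nUq => /homeo_inj ->.
have [t st] := swap_exists cA dA.
have Ht : H t by apply: (swap_generated cA _ _ dA _ st) => // x [[]].
have Gt := HG Ht.
case: st => t1 t2 t3.
have tq x : A x -> t (q x) = x by exact: t2.
have tqid x : q x = x -> t (q x) = x.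
  move=> qx; rewrite qx t3 //.
    by move=> Ax; apply: (dA x Ax); rewrite qx.
  move=> y Ay; rewrite -{1}qx => /homeo_inj yx.
  by apply: (dA y Ay); rewrite yx qx -yx.
exists (t * h)%g; rewrite -mulgA -/q; split.
- exact: (group_closed_inM gH).
- split; first exact: (group_closed_inM gG).
  by move=> x nUx; rewrite homeo_mulE tqid // qU.
- move=> x nVx; rewrite homeo_mulE.
  (* If [q x] lies in [A], then [t] sends it on to [q (q x)]; as [A] is off [V], [b] is preserved
     both times. *)
  have [Aqx|[y Ay /homeo_inj ->]|[n1 n2]] := swap_case A q (q x).
  + by rewrite t1 // qb ?qb //; case: Aqx => [[]].
  + by rewrite tq.
  + by rewrite t3 // qb.
- move=> x nVx; rewrite ltnS leq_eqVlt homeo_mulE => /orP[/eqP lx|lx].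
    have [Ax|nAx] := pselect (A x); first exact: tq.
    apply: tqid; have [Ux|/qU//] := pselect (U x).
    apply: bl_inj; first exact: qb.
    by rewrite lx; apply: contrapT => nl; apply: nAx; split.
  by apply: tqid; exact: qid.
Qed.

(** * First hitting times *)

(** The bound [L] comes from compactness: near each point one fixed visiting time works. *)
Lemma hitting_time_exists (Y : set X) : clopen Y -> Y !=set0 ->
  exists l : X -> nat, [/\ forall x, Y (iter (l x) f x),
    forall x i, i < l x -> ~ Y (iter i f x) & exists L, forall x, l x < L].
Proof.
move=> cY Y0.
have ex x : exists n, `[< Y (iter n f x) >].
  by have [n Yn] := minimal_visit hf x cY.1 Y0; exists n; exact/asboolP.
exists (fun x => ex_minn (ex x)); split.
- by move=> x; case: ex_minnP => n /asboolP.
- move=> x i; case: ex_minnP => n _ nmin ni Yi.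
  by have := nmin i (asboolT Yi); lia.
pose Q (B : set X) :=
  exists L, forall x, B x -> exists2 i, i < L & Y (iter i f x).
have [L hL] : Q setT.
  apply: (compact_set_ind cX).
  - by exists 0.
  - by move=> A B AB [N hN]; exists N => x /AB; exact: hN.
  - move=> A B [M hM] [N hN]; exists (M + N) => x [/hM|/hN] [i iN Yi];
    by exists i => //; lia.
  - move=> x; have [n Yn] := minimal_visit hf x cY.1 Y0.
    exists (iter n f @^-1` Y); last by exists n.+1 => y Yy; exists n.
    by apply: clopen_nbhs => //; exact: clopen_iter.
exists L => x; have [//|i iL Yi] := hL x.
by case: ex_minnP => n _ /(_ i (asboolT Yi)); lia.
Qed.

(** The set [k < l x] is the set [k <= l x] minus the preimage of [Y] under [f^k], so these sets are
    clopen by induction. *)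
Lemma clopen_hitting_time (Y : set X) (l : X -> nat) : clopen Y ->
  (forall x, Y (iter (l x) f x)) ->
  (forall x i, i < l x -> ~ Y (iter i f x)) ->
  forall m, clopen [set x | l x = m].
Proof.
move=> cY lY lmin m.
have cl k : clopen [set x | k <= l x].
  elim: k => [|k IH].
    by rewrite (_ : mkset _ = setT); [exact: clopenT|exact/seteqP].
  rewrite (_ : mkset _ = [set x | k <= l x] `&` ~` (iter k f @^-1` Y)).
    by apply: clopenI => //; exact/clopenC/clopen_iter.
  apply/seteqP; split => x /=.
    by move=> kl; split; [exact: ltnW|exact: lmin].
  move=> [kl nY]; rewrite ltn_neqAle kl andbT.
  by apply/eqP => e; apply: nY; rewrite /= e; exact: lY.
rewrite (_ : mkset _ = [set x | m <= l x] `&` ~` [set x | m < l x]).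
  by apply: clopenI => //; exact: clopenC.
by apply/seteqP; split => x /= [*]; lia.
Qed.

(** With no visit before time [a], the first visit from [f^a u] is that from [u], reached [a] steps
    sooner. The hitting point thus labels orbit segments. *)
Lemma hitting_iter (Y : set X) (l : X -> nat) a (u : X) :
  (forall x, Y (iter (l x) f x)) ->
  (forall x i, i < l x -> ~ Y (iter i f x)) ->
  (forall i, i < a -> ~ Y (iter i f u)) ->
  iter (l (iter a f u)) f (iter a f u) = iter (l u) f u.
Proof.
move=> lY lmin nY; rewrite -iterD.
suff -> : l u = l (iter a f u) + a by [].
have al : a <= l u.
  by rewrite leqNgt; apply/negP => /nY; apply; exact: lY.
apply/eqP; rewrite eqn_leq; apply/andP; split.
- rewrite leqNgt; apply/negP => /lmin; apply.
  by rewrite iterD; exact: lY.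
- rewrite leqNgt; apply/negP => lt.
  apply: (lmin (iter a f u) (l u - a)); first by lia.
  by rewrite -iterD subnK.
Qed.

(** * Reduction of an arbitrary element to one supported in [W] *)

Lemma local_subgroup_generated : local_subgroup G U `<=` H.
Proof.
move=> g gUg; have [Gg gU] := gUg.
have [N hN] := full_amplification_bounded cX Gg.
have [x _] := W0.
(* These [2N + 1] levels leave [N] on each side of the middle one, [Z], so every point that [g]
   carries into another orbit segment lies in [V]. *)
have [Y [cY Yx] [_ /(_ Y cY (fun _ Yy => Yy)) [k [Hk kW _]]]] :=
  absorb_levels x (N + N).+1.
pose V := [set z | exists2 i, i < (N + N).+1 & exists2 y, Y y & iter i f y = z].
have cV : clopen V by exact: clopen_levels.
pose Z := (f ^+ N)^-1%g @^-1` Y.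
have ZP z : Z z -> exists2 y, Y y & z = iter N f y.
  by move=> Zz; exists ((f ^+ N)^-1%g z) => //; rewrite -homeo_expE homeo_mulKV.
have cZ : clopen Z by exact: clopen_homeo.
have Z0 : Z !=set0.
  by exists (iter N f x); rewrite -homeo_expE /Z /= homeo_funK.
have [l [lZ lmin [L lL]]] := hitting_time_exists cZ Z0.
pose b z := iter (l z) f z.
have [|||h Hh [Gq qUV]] := @clear_levels _ b l L V g _ _ lL cV gUg.
- by move=> y z; rewrite /b => + e; rewrite e; exact: homeo_iter_inj.
- exact: clopen_hitting_time lZ lmin.
- move=> z nVz; have [a [c [aN cN e]]] := hN z.
  rewrite /b -(@hitting_iter Z l a (g z)) //.
    rewrite e (@hitting_iter Z l c z) // => i ic /ZP[y Yy iy]; apply: nVz.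
    exists (N - i); first by lia.
    exists y => //; apply: (@homeo_iter_inj _ f i).
    by rewrite -iterD iy; congr iter; lia.
  (* A visit of [g z] to [Z] at time [i < a] would put [z] on level [N + (a - i) - c], which is
     between 0 and [2N] since [a] and [c] are at most [N]. *)
  move=> i ia /ZP[y Yy iy]; apply: nVz.
  exists (N + (a - i) - c); first by lia.
  exists y => //; apply: (@homeo_iter_inj _ f c).
  have <- : iter (a - i) f (iter i f (g z)) = iter c f z.
    by rewrite -iterD subnK // ltnW.
  by rewrite iy -!iterD; congr iter; lia.
set q := (h * g)%g in Gq qUV.
(* [q] is supported in [V] and [U], which [k] carries into [W]; the conjugate is thus supported in
   any [V1] given by [coverH]. *)
suff Hkq : H (k * q * k^-1)%g.
  rewrite (_ : g = h^-1 * (k^-1 * (k * q * k^-1) * k))%g.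
    have HV := group_closed_inV gH; have HM := group_closed_inM gH.
    by apply: (HM); [exact: HV|apply: (HM) => //; apply: (HM) => //; exact: HV].
  by rewrite !mulgA !mulgVK mulVg mul1g.
have [w Ww] := W0; have [V1 [_ WV1 _ +]] := coverH (WU Ww); apply.
have Gk := HG Hk; split.
  apply: (group_closed_inM gG); last exact: (group_closed_inV gG).
  exact: (group_closed_inM gG).
move=> y nV1y; rewrite 2!homeo_mulE qUV ?homeo_mulKV //.
move=> [Uu [i iN [z Yz zE]]]; apply: nV1y; apply: WV1.
by rewrite -(homeo_mulKV k y) -zE; apply: kW => //; rewrite zE.
Qed.

End LocalGroups.

(** * Property E for the ample group of a minimal homeomorphism *)

Theorem theorem1p7 (X : topologicalType) (hX : cantor_set X)
  (f : homeo X X) (hf : minimal f) :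
  property_E (full_amplification (generated [set f])).
Proof.
move=> U1 U2 cU1 cU2 U120.
set G := full_amplification (generated [set f]).
have locS (U U' : set X) : U `<=` U' ->
    local_subgroup G U `<=` local_subgroup G U'.
  by move=> UU' g [Gg gU]; split => // x nU'x; apply: gU => /UU'.
have sub : generated (local_subgroup G U1 `|` local_subgroup G U2) `<=`
    local_subgroup G (U1 `|` U2).
  apply: generated_sub; first exact/local_subgroup_closed/generated_closed.
  by move=> g [|]; apply: locS; [exact: subsetUl|exact: subsetUr].
apply/seteqP; split => //.
apply: (@local_subgroup_generated X f hX hf (U1 `|` U2) (U1 `&` U2)) => //.
- exact: clopenU.
- exact: clopenI.
- by move=> x []; left.
- exact: generated_closed.
- by move=> g /sub[].
- move=> x [U1x|U2x]; [exists U1|exists U2]; split => //.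
  + by move=> g gU; apply: sub_generated; left.
  + by move=> g gU; apply: sub_generated; right.
Qed.
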